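(* Let $\Delta_2=\{T_1,T_2\}$ be a 2-cell in $\mathbb{R}^n$. For every integer $r\ge0$, $$\operatorname{mos} S^r(\Delta_2)=r+(n-1)(r+1).$$
   Context: 2-cell: let $T$ be an $n$-dimensional simplex in $\mathbb{R}^n$, choose a point $v$ in the interior of $T$ and connect it to just one $(n-1)$-face of $T$, forming the simplex $T_1\subset T$ (the convex hull of $v$ and that face). Let $T_2$ be the closure of $T\setminus T_1$. The 2-cell is $\Delta_2=\{T_1,T_2\}$. The intersection $T_1\cap T_2$ is the union of $n$ faces $F_1,\dots,F_n$ of $T_1$ of dimension $n-1$ (those containing $v$). A spline on $\Delta_2$ is a pair $\sigma=\{(U_{T_1},f_{T_1}),(U_{T_2},f_{T_2})\}$ with $U_{T_i}\subset\mathbb{R}^n$ open, $T_i\subset U_{T_i}$ and $f_{T_i}\in C^\infty(U_{T_i})$ real-valued; $S(\Delta_2)$ is the set of all such splines. For a multi-index $\alpha$, $D^\alpha$ is the corresponding partial derivative, of order $|\alpha|$. $S^r(\Delta_2)$ is the set of $\sigma\in S(\Delta_2)$ with $D^\alpha f_{T_1}|_{F_i}=D^\alpha f_{T_2}|_{F_i}$ for all $|\alpha|\le r$ and $i=1,\dots,n$. $C^\rho(\Delta_2)$ is the set of $\sigma\in S(\Delta_2)$ with $D^\alpha f_{T_1}(v)=D^\alpha f_{T_2}(v)$ for all $|\alpha|\le\rho$. The maximal order of supersmoothness is $\operatorname{mos} S^r(\Delta_2)=\max\{\rho\ge r: S^r(\Delta_2)\subset C^\rho(\Delta_2)\}$ ($\rho$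 an integer). *)

(* Defs.v *)
From HB Require Import structures.
From mathcomp Require Import all_boot all_order all_algebra.
From mathcomp Require Import all_classical all_reals all_analysis.

Set Implicit Arguments.
Unset Strict Implicit.
Unset Printing Implicit Defensive.

Import Order.TTheory GRing.Theory Num.Theory.
Import numFieldNormedType.Exports.

Local Open Scope classical_set_scope.
Local Open Scope ring_scope.

Definition conv_hull (R : numDomainType) (V : lmodType R) (A : set V) : set V :=
  smallest (@convex_set R V) A.

Lemma convex_conv_hull (R : numDomainType) (V : lmodType R) (A : set V) :
  convex_set (conv_hull A).
Proof.
move=> x y l; rewrite !inE => xA yA C CA.
by have := CA.1 x y l; rewrite !inE; apply; [exact: xA|exact: yA].
Qed.

Section Simplices.
Context {R : realType} {n : nat}.
Implicit Type p : 'I_n.+1 -> 'rV[R]_n.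

Definition affinely_independent p : Prop :=
  free [seq p (lift ord0 i) - p ord0 | i : 'I_n].

Definition simplex p : set 'rV[R]_n := conv_hull (range p).

(* The (n-1)-face opposite to the vertex [p j]. *)
Definition facet p (j : 'I_n.+1) : set 'rV[R]_n :=
  conv_hull (p @` [set i | i != j]).

End Simplices.

Section Derivatives.
Context {R : realType} {n : nat}.
Implicit Types (f : 'rV[R]_n -> R) (U : set 'rV[R]_n).

Definition partial (i : 'I_n) f : 'rV[R]_n -> R :=
  'D_('e_i) f.

(* [partials [:: i1; ...; ik] f] is d/dx_i1 (... (d/dx_ik f)). *)
Definition partials (s : seq 'I_n) f : 'rV[R]_n -> R := foldr partial f s.

(* On a smooth function the order in which the partial derivatives are taken
   is immaterial; here those in the first coordinate are taken last. *)
Definition multi_partial (alpha : 'I_n -> nat) f : 'rV[R]_n -> R :=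
  partials (flatten [seq nseq (alpha i) i | i <- enum 'I_n]) f.

Definition multi_order (alpha : 'I_n -> nat) : nat := (\sum_(i < n) alpha i)%N.

(* For [U] open: iterated partial derivatives of all orders, taken in any order
   of the variables, exist and are continuous at every point of [U].  The values
   of [f] outside [U] are irrelevant, so a total [f] represents a function
   on [U]. *)
Definition smooth_on U f : Prop :=
  forall (s : seq 'I_n) x, U x ->
    {for x, continuous (partials s f)} /\
    forall i : 'I_n, derivable (partials s f) x 'e_i.

End Derivatives.

Record two_cell (R : realType) (n : nat) := TwoCell {
  cell_vertex : 'I_n.+1 -> 'rV[R]_n;
  cell_indep : affinely_independent cell_vertex;
  cell_center : 'rV[R]_n;
  cell_centerP : (simplex cell_vertex)° cell_center;
  (* the face joined to the centre is the one opposite to this vertex *)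
  cell_opp : 'I_n.+1 }.

Section Splines.
Context {R : realType} {n : nat}.
Implicit Type D : two_cell R n.

Definition cell_T D : set 'rV[R]_n := simplex (cell_vertex D).

Definition cell_T1 D : set 'rV[R]_n :=
  conv_hull (cell_center D |` facet (cell_vertex D) (cell_opp D)).

Definition cell_T2 D : set 'rV[R]_n := closure (cell_T D `\` cell_T1 D).

Definition cell_T1_vertex D : 'I_n.+1 -> 'rV[R]_n :=
  fun i => if i == cell_opp D then cell_center D else cell_vertex D i.

Lemma cell_T1_simplex D : cell_T1 D = simplex (cell_T1_vertex D).
Proof.
apply/seteqP; split; apply: smallest_sub; try exact: convex_conv_hull.
  move=> x [->|].
    apply: sub_gen_smallest; exists (cell_opp D) => //.
    by rewrite /cell_T1_vertex eqxx.
  apply: smallest_sub x; first exact: convex_conv_hull.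
  move=> _ [i /= /negbTE ik <-]; apply: sub_gen_smallest; exists i => //.
  by rewrite /cell_T1_vertex ik.
move=> _ [i _ <-]; rewrite /cell_T1_vertex; apply: sub_gen_smallest.
case: eqP => [_|/eqP ik]; first by left.
by right; apply: sub_gen_smallest; exists i.
Qed.

(* The set {F_1, ..., F_n} of (n-1)-faces of [cell_T1 D] containing the
   centre; their union is the intersection of the two pieces. *)
Definition interior_faces D : set (set 'rV[R]_n) :=
  [set F | F (cell_center D) /\ exists j, F = facet (cell_T1_vertex D) j].

Record spline D := Spline {
  spline_U1 : set 'rV[R]_n;
  spline_f1 : 'rV[R]_n -> R;
  spline_U2 : set 'rV[R]_n;
  spline_f2 : 'rV[R]_n -> R;
  spline_U1_open : open spline_U1;
  spline_U1_sub : cell_T1 D `<=` spline_U1;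
  spline_f1_smooth : smooth_on spline_U1 spline_f1;
  spline_U2_open : open spline_U2;
  spline_U2_sub : cell_T2 D `<=` spline_U2;
  spline_f2_smooth : smooth_on spline_U2 spline_f2 }.

Definition spline_Sr D (r : nat) : set (spline D) :=
  [set sigma | forall alpha, (multi_order alpha <= r)%N ->
     forall F, interior_faces D F -> forall x, F x ->
       multi_partial alpha (spline_f1 sigma) x = multi_partial alpha (spline_f2 sigma) x].

Definition spline_Crho D (rho : nat) : set (spline D) :=
  [set sigma | forall alpha, (multi_order alpha <= rho)%N ->
     multi_partial alpha (spline_f1 sigma) (cell_center D) =
     multi_partial alpha (spline_f2 sigma) (cell_center D)].

Arguments spline_Sr D r : clear implicits.
Arguments spline_Crho D rho : clear implicits.

(* "mos S^r(D) = m": the maximum is a relation, so that the equality also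
   asserts that the maximum exists. *)
Definition mos_Sr D (r m : nat) : Prop :=
  let orders := [set rho : nat | (r <= rho)%N /\ spline_Sr D r `<=` spline_Crho D rho] in
  orders m /\ ubound orders m.

End Splines.

Arguments spline_Sr {R n} D r _.
Arguments spline_Crho {R n} D rho _.

(* Main.v *)
Require Import Defs.
From mathcomp Require Import all_boot all_order all_algebra.
From mathcomp Require Import all_classical all_reals all_analysis.
From mathcomp Require Import ring lra.

(** The number in the theorem is [n * r.+1 - 1].  Let [g] be the difference of the
    two pieces of a spline; it is smooth near the centre [v], and all its
    derivatives of order at most [r] vanish on the [n] interior faces [F i],
    which span the coordinate hyperplanes of the frame of edges [e j] of the inner
    simplex at [v].

    For the lower bound, take a derivative of [g] at [v] of order less than
    [n * r.+1] in directions [e j].  Some edge [e i] is used at most [r] times.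
    As directional derivatives of smooth functions commute, the derivatives along
    [e i] may be taken first; the result vanishes on [F i], and the remaining
    derivatives, being along directions tangent to [F i], keep it zero there
    ([flat_faces_derives_eq0]).  Multilinearity in the directions passes from edges
    to coordinate directions ([derives_span_eq0]).  Two facts from calculus support
    this: linearity of [D_u f] in [u] ([is_derive_add_dir]) and Schwarz's theorem
    ([derive_comm]), both consequences of the mean value theorem on a line.  They
    show that a function with continuous iterated partial derivatives has
    iterated derivatives along arbitrary vectors ([smooth_along_span]).

    The tangency argument uses only that [F i] is convex and contains [v] and
    [v + e j] for [j != i]: at [x] in [F i] both [v + e j - x] and [v - x] point
    into [F i], and [e j] is their difference.

    For the upper bound, glue 0 on the outer piece with the product of the powers
    [bary i ^+ r.+1] of the [n] barycentric coordinates of the inner simplex that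
    vanish at [v].  Each factor makes the product flat of order [r] on one face
    ([derives_pow_eq0]), but along a suitable line through [v] the product is
    [t ^+ (n * r.+1)] ([wall_spline_NCrho]). *)

Set Implicit Arguments.
Unset Strict Implicit.
Unset Printing Implicit Defensive.

Import Order.TTheory GRing.Theory Num.Theory.
Import numFieldNormedType.Exports.

Local Open Scope classical_set_scope.
Local Open Scope ring_scope.

(** * Directional derivatives along lines *)

Lemma ler_dist_split {R : realFieldType} (a b c e : R) :
  `|a - c| < e / 2 -> `|b - c| < e / 2 -> `|a - b| <= e.
Proof.
move=> ac bc; rewrite (splitr e) (le_trans (ler_distD c _ _))//.
by rewrite lerD ?ltW// distrC.
Qed.

Section DirectionalDerivatives.
Context {R : realType} {V : normedModType R}.
Implicit Types (f g : V -> R) (u w x y : V).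

Lemma near_ray x u (N : set V) : nbhs x N ->
  \forall t \near (0 : R)^'+, N (x + t *: u).
Proof.
have : x + t *: u @[t --> (0 : R)^'+] --> x + 0 *: u.
  apply: cvg_at_right_filter.
  by apply: cvgD; [exact: cvg_cst|apply: cvgZr_tmp; exact: cvg_id].
by rewrite scale0r addr0; exact.
Qed.

Lemma nbhs_ray x u (N : set V) : nbhs x N ->
  exists2 t : R, 0 < t & N (x + t *: u).
Proof.
move=> /(near_ray u) Nu.
by have [t [t0 Nt]] := filter_ex (filterI (nbhs_right_gt (0 : R)) Nu); exists t.
Qed.

Lemma is_derive_line f x u (t d : R) :
  is_derive (x + t *: u) u f d ->
  is_derive t (1 : R) (fun s : R => f (x + s *: u)) d.
Proof.
have E : (fun h : R => h^-1 *: (((fun s : R => f (x + s *: u)) \o shift t)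
            (h *: (1 : R)) - f (x + t *: u)))
       = (fun h : R => h^-1 *: ((f \o shift (x + t *: u)) (h *: u)
            - f (x + t *: u))).
  apply/funext => h /=; congr (_ *: (f _ - _)).
  by rewrite [_%:A]mulr1 scalerDl addrCA.
by case=> df dE; apply: DeriveDef; rewrite ?/derivable ?/derive E.
Qed.

(** Differentiating along [c *: u] is differentiating the restriction to the line
    along [c]; a one-variable function is differentiable, hence linear in [c]. *)
Lemma is_derive_scale_dir f x u (c d : R) :
  is_derive x u f d -> is_derive x (c *: u) f (c * d).
Proof.
move=> dfu; set phi := fun s : R => f (x + s *: u).
have dphi : is_derive (0 : R) (1 : R) phi d.
  by apply: is_derive_line; rewrite scale0r addr0.
have diffphi : differentiable phi 0 by apply/derivable1_diffP; case: dphi.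
have E : (fun h : R => h^-1 *: ((phi \o shift 0) (h *: c) - phi 0))
       = (fun h : R => h^-1 *: ((f \o shift x) (h *: (c *: u)) - f x)).
  apply/funext => h /=; rewrite /phi addr0 scale0r addr0.
  by congr (_ *: (f _ - _)); rewrite scalerA addrC.
have dc : derivable phi 0 c by apply: diff_derivable.
have vc : 'D_c phi 0 = c * d.
  rewrite deriveE// -[c in LHS]mulr1 [c * 1]/(c *: (1 : R)) linearZ/=.
  by rewrite -deriveE// (@derive_val _ _ _ _ _ _ _ dphi).
by apply: DeriveDef; move: dc vc; rewrite ?/derivable ?/derive E.
Qed.

(** Allowing [h] of both signs spares the two-sided limits below a case
    distinction; for [h < 0] the direction is reversed. *)
Lemma mean_value_line f x u (h : R) :
  (forall t : R, `|t| <= `|h| -> derivable f (x + t *: u) u) ->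
  exists2 t : R, `|t| <= `|h| &
    f (x + h *: u) - f x = h * 'D_u f (x + t *: u).
Proof.
wlog h0 : h u / 0 <= h => [wh|] df.
  have [/wh/(_ df)//|hlt0] := leP 0 h.
  have negdir y : derivable f y u -> is_derive y (- u) f (- 'D_u f y).
    move=> /derivableP/(@is_derive_scale_dir _ _ _ (-1) _).
    by rewrite scaleN1r mulN1r.
  have [||t tle] := wh (- h) (- u).
  - by rewrite oppr_ge0 ltW.
  - move=> t; rewrite normrN => th.
    suff /negdir[]: derivable f (x + t *: - u) u by [].
    by rewrite scalerN -scaleNr; apply: df; rewrite normrN.
  rewrite normrN in tle.
  rewrite !scalerN -scaleNr opprK => ->; exists (- t).
    by rewrite normrN.
  have /negdir[_] : derivable f (x + - t *: u) u by apply: df; rewrite normrN.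
  by rewrite [in X in X -> _]scaleNr => ->; rewrite scaleNr mulrNN.
pose phi (s : R) := f (x + s *: u).
have dphi s : s \in `[0, h] ->
    is_derive s (1 : R) phi ('D_u f (x + s *: u)).
  move=> /itvP sh; apply/is_derive_line/derivableP/df.
  by rewrite !ger0_norm ?sh.
have cphi : {within `[0, h], continuous phi}.
  by apply: derivable_within_continuous => s /dphi[].
have dphio s : s \in `]0, h[ -> is_derive s (1 : R) phi ('D_u f (x + s *: u)).
  by move=> /subset_itv_oo_cc/dphi.
have [c /itvP ch E] := MVT_segment h0 dphio cphi.
exists c; first by rewrite !ger0_norm ?ch.
by move: E; rewrite /phi scale0r addr0 subr0 mulrC.
Qed.

(** Going from [x] to [x + h *: (u + w)] through [x + h *: u], the first leg has
    slope [D_u f x] in the limit, and by the mean value theorem the second has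
    slope [D_w f] at a point close to [x], where [D_w f] is close to [D_w f x]. *)
Lemma is_derive_add_dir f x u w :
  (\near x, derivable f x w) -> derivable f x u ->
  {for x, continuous ('D_w f)} ->
  is_derive x (u + w) f ('D_u f x + 'D_w f x).
Proof.
move=> dw du cw.
suff H : h^-1 *: ((f \o shift x) (h *: (u + w)) - f x) @[h --> (0 : R)^']
    --> 'D_u f x + 'D_w f x.
  by apply: DeriveDef; [apply/cvg_ex; eexists; exact: H|exact: cvg_lim H].
have -> : (fun h : R => h^-1 *: ((f \o shift x) (h *: (u + w)) - f x)) =
    (fun h : R => h^-1 *: ((f \o shift x) (h *: u) - f x)) +
    (fun h : R => h^-1 *: (f (x + h *: u + h *: w) - f (x + h *: u))).
  apply/funext => h /=; rewrite -[RHS]/(_ + _) -scalerDr; congr (_ *: _).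
  rewrite scalerDr (addrC (h *: u) x) (addrC _ x) (addrA x).
  by rewrite [RHS]addrC addrA subrK.
apply: cvgD; first exact: du.
apply/cvgrPdist_lt => e e0.
have /cvgrPdist_lt/(_ e e0) ce := cw.
have [d /= d0 bd] : nbhs_ball x
    [set y | derivable f y w /\ `|'D_w f x - 'D_w f y| < e].
  by apply/nbhs_ballP; apply: filterI.
have M0 : 0 < `|u| + `|w| + 1 by rewrite ltr_wpDl ?addr_ge0.
rewrite near_withinE.
near=> h => h0.
(* The whole second leg stays in the ball where [D_w f] is close to [D_w f x]. *)
have small t : `|t| <= `|h| -> ball x d (x + h *: u + t *: w).
  move=> th; rewrite -ball_normE /= -addrA opprD addNKr normrN.
  apply: (@le_lt_trans _ _ (`|h| * (`|u| + `|w| + 1))).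
    rewrite (le_trans (ler_normD _ _))// !normrZ !mulrDr mulr1.
    by rewrite -addrA lerD2l (le_trans (ler_wpM2r _ th))// lerDl.
  rewrite -ltr_pdivlMr//; near: h; rewrite nearE; apply/nbhs_ballP.
  exists (d / (`|u| + `|w| + 1)) => /=; first exact: divr_gt0.
  by move=> h; rewrite -ball_normE /= sub0r normrN.
have [|t th ->] := @mean_value_line f (x + h *: u) w h.
  by move=> t /small/bd[].
by rewrite [_ *: _]mulKf//; have /small/bd[] := th.
Unshelve. all: by end_near. Qed.

(** The left-hand side is symmetric in [u] and [w], the right-hand side is not:
    this is where Schwarz's theorem comes from. *)
Lemma second_difference f x u w (h : R) :
  (forall s t : R, `|s| <= `|h| -> `|t| <= `|h| ->
     let y := x + s *: u + t *: w in
     derivable f y u /\ derivable ('D_u f) y w) ->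
  exists s t : R, [/\ `|s| <= `|h|, `|t| <= `|h| &
    f (x + h *: u + h *: w) - f (x + h *: w) - f (x + h *: u) + f x
    = h ^+ 2 * 'D_w ('D_u f) (x + s *: u + t *: w)].
Proof.
move=> df.
(* The double increment is the increment of [g] along [h *: u]; the mean value
   theorem applies to [g] along [u], then to [D_u f] along [w]. *)
pose g y := f (y + h *: w) - f y.
have dshift y : derivable f (y + h *: w) u ->
    is_derive y u (fun z => f (z + h *: w)) ('D_u f (y + h *: w)).
  have E : (fun k : R => k^-1 *: (((fun z => f (z + h *: w)) \o shift y)
               (k *: u) - f (y + h *: w)))
         = (fun k : R => k^-1 *: ((f \o shift (y + h *: w)) (k *: u)
               - f (y + h *: w))).
    by apply/funext => k /=; rewrite addrA.
  by move=> d; apply: DeriveDef; rewrite ?/derivable ?/derive E.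
have dg s : `|s| <= `|h| -> is_derive (x + s *: u) u g
    ('D_u f (x + s *: u + h *: w) - 'D_u f (x + s *: u)).
  move=> sh; apply: is_deriveB.
    by have [d _] := df s h sh (lexx _); exact: dshift d.
  have [] := df s 0 sh; first by rewrite normr0 normr_ge0.
  by rewrite scale0r addr0 => d _; exact: derivableP d.
have [s /dg[]//|s sh gE] := @mean_value_line g x u h.
have [t th|t th tE] := @mean_value_line ('D_u f) (x + s *: u) w h.
  by have [] := df s t sh th.
exists s, t; split => //.
have [_ gs] := dg s sh; rewrite gs tE mulrA -expr2 in gE.
by rewrite -gE /g; ring.
Qed.

(** Schwarz's theorem: for small [h] the same increment, divided by [h ^+ 2],
    is a value of [D_w D_u f] and a value of [D_u D_w f], both near [x]. *)
Lemma derive_comm f x u w :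
  (\near x, [/\ derivable f x u, derivable ('D_u f) x w,
                derivable f x w & derivable ('D_w f) x u]) ->
  {for x, continuous ('D_w ('D_u f))} -> {for x, continuous ('D_u ('D_w f))} ->
  'D_w ('D_u f) x = 'D_u ('D_w f) x.
Proof.
move=> df c1 c2; apply/eqP; rewrite -subr_eq0 -normr_le0.
apply/ler_addgt0Pl => e e0; rewrite addr0.
have e20 : 0 < e / 2 by rewrite divr_gt0.
have /cvgrPdist_lt/(_ _ e20) ce1 := c1.
have /cvgrPdist_lt/(_ _ e20) ce2 := c2.
have [d /= d0 bd] : nbhs_ball x
    [set y | [/\ derivable f y u, derivable ('D_u f) y w,
                derivable f y w & derivable ('D_w f) y u] /\
      (`|'D_w ('D_u f) x - 'D_w ('D_u f) y| < e / 2 /\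
       `|'D_u ('D_w f) x - 'D_u ('D_w f) y| < e / 2)].
  by apply/nbhs_ballP; exact: filterI df (filterI ce1 ce2).
have M0 : 0 < `|u| + `|w| + 1 by rewrite ltr_wpDl ?addr_ge0.
(* Small enough for the parallelogram at [x] with sides [h *: u] and [h *: w] to
   lie in the ball of radius [d]. *)
pose h := d / 2 / (`|u| + `|w| + 1).
have h0 : 0 < h by rewrite !divr_gt0.
have small s t : `|s| <= `|h| -> `|t| <= `|h| -> ball x d (x + s *: u + t *: w).
  rewrite (gtr0_norm h0) => sh th; rewrite -ball_normE /= -addrA opprD addNKr.
  rewrite normrN; apply: (@le_lt_trans _ _ (d / 2)); last by lra.
  rewrite -(divfK (lt0r_neq0 M0) (d / 2)) -/h.
  rewrite (le_trans (ler_normD _ _))// !normrZ !mulrDr mulr1.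
  apply: (@le_trans _ _ (h * `|u| + h * `|w|)); last by rewrite lerDl ltW.
  by rewrite lerD// ler_wpM2r.
have [s t sh th|s [t [sh th E1]]] := @second_difference f x u w h.
  by have [[d1 d2 _ _] _] := bd _ (small s t sh th); exact: conj d1 d2.
have [s' t' sh' th'|s' [t' [sh' th' E2]]] := @second_difference f x w u h.
  have [[_ _ d1 d2] _] := bd _ (small t' s' th' sh').
  by rewrite addrAC; exact: conj d1 d2.
have [_ [lt1 _]] := bd _ (small s t sh th).
have := bd _ (small t' s' th' sh'); rewrite addrAC => -[_ [_ lt2]].
have E : 'D_w ('D_u f) (x + s *: u + t *: w) =
         'D_u ('D_w f) (x + s' *: w + t' *: u).
  have h2 : h ^+ 2 != 0 by rewrite expf_neq0 ?lt0r_neq0.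
  apply: (mulfI h2); apply: (etrans (esym E1)); apply: (etrans _ E2).
  by rewrite (addrAC x (h *: w)); congr (_ + _); exact: addrAC.
rewrite E in lt1.
exact: ler_dist_split lt1 lt2.
Qed.

End DirectionalDerivatives.

(** * Iterated directional derivatives and smoothness *)

Section IteratedDerivatives.
Context {R : realType} {V : normedModType R}.
Implicit Types (f g : V -> R) (u w x : V) (us ws : seq V) (B W : set V).

Definition derives us f : V -> R := foldr (fun u g => 'D_u g) f us.

Lemma derives_cat us ws f : derives (us ++ ws) f = derives us (derives ws f).
Proof. exact: foldr_cat. Qed.

(** Only the directions in [B] are differentiated along: with [B] the standard
    basis this is the usual smoothness on [W], with [B] everything it is the
    form that can be used freely; [smooth_along_span] links the two. *)
Definition smooth_along B W f :=
  forall us, (forall u, u \in us -> B u) -> forall x, W x ->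
    {for x, continuous (derives us f)} /\
    forall u, B u -> derivable (derives us f) x u.

Lemma smooth_continuous B W f x :
  smooth_along B W f -> W x -> {for x, continuous f}.
Proof. by move=> sf Wx; have [|//] := sf [::] _ x Wx. Qed.

Lemma smooth_derivable B W f u x :
  smooth_along B W f -> B u -> W x -> derivable f x u.
Proof. by move=> sf Bu Wx; have [|_] := sf [::] _ x Wx; last exact. Qed.

Lemma near_eq_continuous f g x : (\near x, f x = g x) ->
  {for x, continuous f} -> {for x, continuous g}.
Proof.
move=> nfg; rewrite /prop_for /continuous_at (nbhs_singleton nfg).
exact: cvg_trans (near_eq_cvg _).
Qed.

Lemma eq_derive_on W f g u x : open W -> (forall y, W y -> f y = g y) ->
  W x -> 'D_u f x = 'D_u g x.
Proof.
move=> oW fg Wx; apply: near_eq_derive.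
by apply: filterS (open_nbhs_nbhs (conj oW Wx)).
Qed.

Lemma eq_derives_on W f g us : open W -> (forall y, W y -> f y = g y) ->
  forall x, W x -> derives us f x = derives us g x.
Proof. by move=> oW fg; elim: us => //= u us IH x; exact: eq_derive_on IH. Qed.

Lemma eq_smooth_along B W f g : open W -> (forall y, W y -> f y = g y) ->
  smooth_along B W f -> smooth_along B W g.
Proof.
move=> oW fg sf us usB x Wx; have [cf df] := sf us usB x Wx.
have nfg : \near x, derives us f x = derives us g x.
  apply: filterS (open_nbhs_nbhs (conj oW Wx)) => y Wy.
  exact: eq_derives_on Wy.
split; last by move=> u Bu; exact: near_eq_derivable nfg (df u Bu).
exact: near_eq_continuous nfg cf.
Qed.

Section OpenSet.
Variables (B W : set V).
Hypothesis oW : open W.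

Lemma smooth_along_derives us f : (forall u, u \in us -> B u) ->
  smooth_along B W f -> smooth_along B W (derives us f).
Proof.
move=> usB sf ws wsB; rewrite -derives_cat; apply: sf => u.
by rewrite mem_cat => /orP[/wsB|/usB].
Qed.

Lemma derivesD f g us : (forall u, u \in us -> B u) ->
  smooth_along B W f -> smooth_along B W g ->
  forall x, W x -> derives us (f + g) x = derives us f x + derives us g x.
Proof.
move=> + sf sg; elim: us => //= u us IH usB x Wx.
have usB' w : w \in us -> B w by move=> wus; apply: usB; rewrite inE wus orbT.
have Bu : B u by apply: usB; rewrite mem_head.
rewrite (@eq_derive_on W _ (derives us f + derives us g) _ _ oW (IH usB') Wx).
have [_ df] := sf us usB' x Wx; have [_ dg] := sg us usB' x Wx.
exact: deriveD (df u Bu) (dg u Bu).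
Qed.

Lemma derivesZ (c : R) f us : (forall u, u \in us -> B u) ->
  smooth_along B W f ->
  forall x, W x -> derives us (c *: f) x = c * derives us f x.
Proof.
move=> + sf; elim: us => //= u us IH usB x Wx.
have usB' w : w \in us -> B w by move=> wus; apply: usB; rewrite inE wus orbT.
have Bu : B u by apply: usB; rewrite mem_head.
rewrite (@eq_derive_on W _ (c *: derives us f) _ _ oW (IH usB') Wx).
have [_ df] := sf us usB' x Wx.
exact: deriveZ (df u Bu).
Qed.

Lemma smooth_alongD f g :
  smooth_along B W f -> smooth_along B W g -> smooth_along B W (f + g).
Proof.
move=> sf sg us usB x Wx.
have [cf df] := sf us usB x Wx; have [cg dg] := sg us usB x Wx.
have nfg : \near x, (derives us f + derives us g) x = derives us (f + g) x.
  apply: filterS (open_nbhs_nbhs (conj oW Wx)) => y Wy.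
  exact/esym/derivesD.
split; last first.
  move=> u Bu; apply: near_eq_derivable nfg _.
  exact: derivableD (df u Bu) (dg u Bu).
by apply: near_eq_continuous nfg _; exact: continuousD cf cg.
Qed.

Lemma smooth_alongZ (c : R) f : smooth_along B W f -> smooth_along B W (c *: f).
Proof.
move=> sf us usB x Wx; have [cf df] := sf us usB x Wx.
have nf : \near x, (c *: derives us f) x = derives us (c *: f) x.
  apply: filterS (open_nbhs_nbhs (conj oW Wx)) => y Wy.
  exact/esym/derivesZ.
split; last first.
  by move=> u Bu; apply: near_eq_derivable nf _; exact: derivableZ (df u Bu).
by apply: near_eq_continuous nf _; exact: cvgZl_tmp cf.
Qed.

End OpenSet.

Section Span.
Variables (B W : set V).
Hypothesis oW : open W.

Let good f u := (forall x, W x -> derivable f x u) /\ smooth_along B W ('D_u f).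

Let good_dir f u : smooth_along B W f -> B u -> good f u.
Proof.
move=> sf Bu; split=> [x Wx|]; first exact: smooth_derivable sf Bu Wx.
by apply: (@smooth_along_derives B W [:: u]) => // w; rewrite inE => /eqP->.
Qed.

Lemma derive_dirD f u w x : W x -> (forall y, W y -> derivable f y u) ->
  (forall y, W y -> derivable f y w) -> {for x, continuous ('D_w f)} ->
  is_derive x (u + w) f ('D_u f x + 'D_w f x).
Proof.
move=> Wx du dw cw.
have nw : \near x, derivable f x w.
  exact: filterS dw (open_nbhs_nbhs (conj oW Wx)).
exact: is_derive_add_dir nw (du x Wx) cw.
Qed.

Let goodD f u w : good f u -> good f w -> good f (u + w).
Proof.
move=> [du su] [dw sw].
have d x : W x -> is_derive x (u + w) f ('D_u f x + 'D_w f x).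
  move=> Wx; exact: derive_dirD Wx du dw (smooth_continuous sw Wx).
split=> [x /d[]//|].
apply: eq_smooth_along (smooth_alongD oW su sw) => // x /d[_ E].
exact: esym E.
Qed.

Let goodZ f u (c : R) : good f u -> good f (c *: u).
Proof.
move=> [du su].
have d x : W x -> is_derive x (c *: u) f (c * 'D_u f x).
  by move=> Wx; apply/is_derive_scale_dir/derivableP/du.
split=> [x /d[]//|].
by apply: eq_smooth_along (smooth_alongZ oW c su) => // x /d[_ E]; exact: esym E.
Qed.

Hypothesis Bspan : forall u, exists (I : finType) (c : I -> R) (b : I -> V),
  (forall i, B (b i)) /\ u = \sum_i c i *: b i.

Let good_span f u : smooth_along B W f -> good f u.
Proof.
move=> sf; have [I [c [b [Bb ->]]]] := Bspan u.
apply: big_ind => [|? ?|i _]; [|exact: goodD|exact/goodZ/good_dir].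
split=> [x _|]; first exact: derivable0.
apply: (eq_smooth_along oW _ (smooth_alongZ oW 0 sf)) => x _.
by rewrite derive0 /= scale0r.
Qed.

(** The vectors along which every smooth function has a derivative that is smooth
    again form a subspace, by [is_derive_add_dir] and [is_derive_scale_dir]. *)
Lemma smooth_along_span f : smooth_along B W f -> smooth_along setT W f.
Proof.
move=> sf us _ x Wx.
have sus : smooth_along B W (derives us f).
  elim: us => [|u us IH]; first exact: sf.
  by have [_ g] := good_span u IH; exact: g.
split=> [|u _]; first exact: smooth_continuous sus Wx.
by have [g _] := good_span u sus; exact: g.
Qed.

End Span.

Section Smooth.
Variable W : set V.
Hypothesis oW : open W.
Notation smooth := (smooth_along setT W).

Lemma smooth_derives us f : smooth f -> smooth (derives us f).
Proof. exact: smooth_along_derives. Qed.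

Lemma derives_dirD f us u w ws x : smooth f -> W x ->
  derives (us ++ (u + w) :: ws) f x =
  derives (us ++ u :: ws) f x + derives (us ++ w :: ws) f x.
Proof.
move=> sf Wx; rewrite !derives_cat.
have sw := smooth_derives ws sf.
have su : smooth (derives (u :: ws) f) := smooth_derives (u :: ws) sf.
have sw' : smooth (derives (w :: ws) f) := smooth_derives (w :: ws) sf.
rewrite -(derivesD oW (fun _ _ => I) su sw' Wx).
apply: eq_derives_on Wx => // y Wy /=.
have d v z (Wz : W z) : derivable (derives ws f) z v := smooth_derivable sw I Wz.
have [_ E] := derive_dirD oW Wy (d u) (d w) (smooth_continuous sw' Wy);
exact: E.
Qed.

Lemma derives_dirZ f us (c : R) u ws x : smooth f -> W x ->
  derives (us ++ (c *: u) :: ws) f x = c * derives (us ++ u :: ws) f x.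
Proof.
move=> sf Wx; rewrite !derives_cat.
have su : smooth (derives (u :: ws) f) := smooth_derives (u :: ws) sf.
rewrite -(derivesZ oW c (fun _ _ => I) su Wx).
apply: eq_derives_on Wx => // y Wy /=.
have d : derivable (derives ws f) y u :=
  smooth_derivable (smooth_derives ws sf) I Wy.
by have [_] := is_derive_scale_dir c (derivableP d).
Qed.

Lemma smooth_alongB f g : smooth f -> smooth g -> smooth (f - g).
Proof.
move=> sf sg; rewrite -(scaleN1r g).
by have := smooth_alongD oW sf (smooth_alongZ oW (-1) sg); exact.
Qed.

Lemma derivesB f g us x : smooth f -> smooth g -> W x ->
  derives us (f - g) x = derives us f x - derives us g x.
Proof.
move=> sf sg Wx; rewrite -(scaleN1r g).
rewrite (derivesD oW (fun _ _ => I) sf (smooth_alongZ oW (-1) sg) Wx).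
by rewrite (derivesZ oW (-1) (fun _ _ => I) sg Wx) mulN1r.
Qed.

Lemma derives_swap f u w x : smooth f -> W x ->
  derives [:: w; u] f x = derives [:: u; w] f x.
Proof.
move=> sf Wx; apply: derive_comm.
- apply: filterS (open_nbhs_nbhs (conj oW Wx)) => y Wy.
  have su := smooth_derives [:: u] sf; have sw := smooth_derives [:: w] sf.
  split; [exact: smooth_derivable sf I Wy|exact: smooth_derivable su I Wy
         |exact: smooth_derivable sf I Wy|exact: smooth_derivable sw I Wy].
- exact: smooth_continuous (smooth_derives [:: w; u] sf) Wx.
- exact: smooth_continuous (smooth_derives [:: u; w] sf) Wx.
Qed.

Lemma derives_perm f us ws x : smooth f -> W x ->
  perm_eq us ws -> derives us f x = derives ws f x.
Proof.
move=> sf.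
have mid u s1 s2 y : W y ->
    derives (s1 ++ u :: s2) f y = derives (u :: s1 ++ s2) f y.
  elim: s1 y => //= w s1 IH y Wy.
  rewrite (@eq_derive_on W _ _ _ _ oW IH Wy).
  exact: derives_swap (smooth_derives (s1 ++ s2) sf) Wy.
elim: us ws x => [|u us IH] ws x Wx.
  by rewrite perm_sym => /perm_nilP->.
move=> p; have uws : u \in ws by rewrite -(perm_mem p) mem_head.
case/splitPr: uws p => s1 s2 p; rewrite mid//=.
apply: eq_derive_on Wx => // y Wy; apply: IH Wy _.
by rewrite -(perm_cons u) (perm_trans p)// -cat1s perm_catCA.
Qed.

End Smooth.

End IteratedDerivatives.

(** * Functions flat along convex faces *)

Lemma sum_count_mem (T : finType) (s : seq T) :
  (\sum_(i : T) count_mem i s = size s)%N.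
Proof.
elim: s => [|j s IH] /=; first by rewrite big1.
rewrite big_split/= IH (bigD1 j)//= eqxx big1 ?addn0 ?add1n//.
by move=> i /negbTE ij; rewrite eq_sym ij.
Qed.

Lemma perm_nseq_count (T : finType) (s : seq T) :
  perm_eq s (flatten [seq nseq (count_mem i s) i | i <- enum T]).
Proof.
apply/allP => i _ /=; rewrite count_flatten -map_comp sumnE big_map big_enum/=.
rewrite (bigD1 i)//= count_nseq/= eqxx mul1n big1 ?addn0// => j /negbTE ji.
by rewrite count_nseq/= ji mul0n.
Qed.

Lemma convex_set_line {R : numDomainType} {V : lmodType R} (F : set V) x y (t : R) :
  convex_set F -> F x -> F y -> 0 <= t <= 1 -> F (x + t *: (y - x)).
Proof.
move=> cF Fx Fy t01.
pose l : {i01 R} := Itv01 (proj1 (andP t01)) (proj2 (andP t01)).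
have -> : x + t *: (y - x) = t *: y + (1 - t) *: x.
  by rewrite scalerBl scale1r addrCA -scalerBr.
by have := cF y x l; rewrite !inE; exact.
Qed.

Section Vanishing.
Context {R : realType} {V : normedModType R}.
Implicit Types (f g h : V -> R) (u v w x y : V) (us : seq V) (W F : set V).
Variable W : set V.
Hypothesis oW : open W.
Notation smooth := (smooth_along setT W).

(** Multilinearity in the directions reduces the vanishing of all derivatives
    of a given order to directions taken in a spanning family. *)
Lemma derives_span_eq0 (I : finType) (e : I -> V) f x (k : nat) :
  (forall u, exists c : I -> R, u = \sum_i c i *: e i) ->
  smooth f -> W x ->
  (forall s : seq I, size s = k -> derives (map e s) f x = 0) ->
  forall us, size us = k -> derives us f x = 0.
Proof.
move=> espan sf Wx f0.
suff H us s : (size us + size s)%N = k -> derives (map e s ++ us) f x = 0.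
  by move=> us usk; apply: (H us [::]); rewrite addn0.
elim: us s => [|u us IH] s sk; first by rewrite cats0; exact: f0.
have [c ->] := espan u.
apply: (big_ind (fun u => derives (map e s ++ u :: us) f x = 0)) =>
  [|u1 u2 h1 h2|i _].
- by rewrite -(scale0r 0) (derives_dirZ oW)// mul0r.
- by rewrite (derives_dirD oW)// h1 h2 addr0.
- rewrite (derives_dirZ oW)// -cat_rcons -map_rcons IH ?mulr0//.
  by rewrite size_rcons addnS.
Qed.

(** Only a one-sided derivative is visible from within [F]; the two-sided one
    exists by smoothness, so it must vanish as well. *)
Lemma derive_convex_eq0 h F x y : smooth h -> convex_set F ->
  (forall z, F z -> W z -> h z = 0) -> F x -> W x -> F y ->
  'D_(y - x) h x = 0.
Proof.
move=> sh cF h0 Fx Wx Fy.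
have dh : derivable h x (y - x) := smooth_derivable sh I Wx.
rewrite /derive (cvg_at_rightE _ _ dh); apply: lim_near_cst.
  exact: norm_hausdorff.
near=> t.
have t0 : 0 < t by near: t; exact: nbhs_right_gt.
have t1 : t < 1 by near: t; exact: nbhs_right_lt.
have Wt : W (x + t *: (y - x)).
  by near: t; exact: near_ray (open_nbhs_nbhs (conj oW Wx)).
rewrite (h0 x Fx Wx) /= addrC h0 ?addr0 ?oppr0 ?scaler0//; last by rewrite addrC.
rewrite addrC; apply: convex_set_line => //.
by rewrite (ltW t0) (ltW t1).
Unshelve. all: by end_near. Qed.

(** The heart of the supersmoothness.  In a derivative of order less than
    [n * r.+1] along the edges [e i], some edge [e i] is used at most [r] times;
    taking these derivatives first, the result vanishes on [F i], and all the
    remaining edges are tangent to [F i]. *)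
Lemma flat_faces_derives_eq0 (n r : nat) (e : 'I_n -> V) (F : 'I_n -> set V) v g :
  smooth g -> W v -> (forall i, convex_set (F i)) -> (forall i, F i v) ->
  (forall i j, j != i -> F i (v + e j)) ->
  (forall i x, F i x -> W x ->
     forall us, (size us <= r)%N -> derives us g x = 0) ->
  forall s : seq 'I_n, (size s < n * r.+1)%N -> derives (map e s) g v = 0.
Proof.
move=> sg Wv cF Fv Fe g0 s ss.
have [i ci] : exists i, (count_mem i s <= r)%N.
  apply/existsP; apply: contraTT ss => /existsPn cs.
  rewrite -leqNgt -(sum_count_mem s) -[n in (n * _)%N]card_ord -sum_nat_const.
  by apply: leq_sum => i _; rewrite ltnNge.
have p : perm_eq (map e s)
    (map e [seq j <- s | j != i] ++ map e [seq j <- s | j == i]).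
  rewrite -map_cat perm_map// perm_sym perm_catC.
  by rewrite (perm_filterC (pred1 i)).
rewrite (derives_perm oW sg Wv p) derives_cat.
set h := derives (map e [seq j <- s | j == i]) g.
have sh : smooth h := smooth_derives _ sg.
have h0 x : F i x -> W x -> h x = 0.
  by move=> Fx Wx; apply: g0 Fx Wx _ _; rewrite size_map size_filter.
suff tangent t : all (predC1 i) t ->
    forall x, F i x -> W x -> derives (map e t) h x = 0.
  by apply: tangent (Fv i) Wv; exact: filter_all.
elim: t => [_|j t IH /= /andP[ji ti]] x Fx Wx; first exact: h0.
have sk : smooth (derives (map e t) h) := smooth_derives _ sh.
have D y (Fy : F i y) : 'D_(y - x) (derives (map e t) h) x = 0 :=
  derive_convex_eq0 sk (cF i) (IH ti) Fx Wx Fy.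
(* Both [v + e j] and [v] lie in [F i], so both directions point from [x] into
   the face. *)
have -> : e j = (v + e j - x) + (-1) *: (v - x).
  by rewrite scaleN1r opprB addrA subrK addrAC subrr add0r.
have := derives_dirD oW [::] (v + e j - x) ((-1) *: (v - x)) [::] sk Wx.
rewrite (derives_dirZ oW [::] _ _ [::] sk Wx) /= => ->.
by rewrite (D _ (Fv i)) (D _ (Fe i j ji)) mulr0 addr0.
Qed.

End Vanishing.

(** * Partial derivatives and polynomial functions *)

Section RowVectors.
Context {R : realType} {n : nat}.
Implicit Types (f g : 'rV[R]_n -> R) (x u : 'rV[R]_n) (us : seq 'rV[R]_n).

Notation basis := (fun i : 'I_n => 'e_i : 'rV[R]_n).

Lemma partialsE (s : seq 'I_n) f : partials s f = derives (map basis s) f.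
Proof. by elim: s => //= i s ->. Qed.

Lemma row_basis_sum u : exists c : 'I_n -> R, u = \sum_i c i *: basis i.
Proof. by exists (u 0); exact: row_sum_delta. Qed.

Lemma smooth_on_along (W : set 'rV[R]_n) f :
  open W -> smooth_on W f -> smooth_along setT W f.
Proof.
move=> oW sf; apply: (@smooth_along_span _ _ (range basis) W oW) => [u|].
  have [c uE] := row_basis_sum u; exists 'I_n, c, basis; split; last exact: uE.
  by move=> i; exists i.
move=> us usB.
have [s ->] : exists s, us = map basis s.
  elim: us usB => [|u us IH] usB; first by exists [::].
  have [i _ <-] := usB u (mem_head _ _).
  have [|s ->] := IH; last by exists (i :: s).
  by move=> w wus; apply: usB; rewrite inE wus orbT.
move=> x Wx; have [cf df] := sf s x Wx; rewrite -partialsE.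
by split=> [|_ [i _ <-]]; [exact: cf|exact: df].
Qed.

(** The order fixed in the definition of [multi_partial] is harmless by
    [derives_perm]. *)
Lemma derives_basis_multi_partial (W : set 'rV[R]_n) f (s : seq 'I_n) x :
  open W -> smooth_along setT W f -> W x ->
  derives (map basis s) f x = multi_partial (fun i => count_mem i s) f x.
Proof.
move=> oW sf Wx; rewrite /multi_partial partialsE.
apply: (derives_perm oW sf Wx); apply: perm_map; exact: perm_nseq_count.
Qed.

Lemma size_multi (alpha : 'I_n -> nat) :
  size (flatten [seq nseq (alpha i) i | i <- enum 'I_n]) = multi_order alpha.
Proof.
rewrite size_flatten /shape -map_comp sumnE big_map big_enum/=.
by apply: eq_bigr => i _; rewrite size_nseq.
Qed.

(** Contact of order [k] at [x] is independent of the coordinates; the standard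
    basis can be traded for the edges of a simplex. *)
Lemma multi_partial_derives (W : set 'rV[R]_n) f g x (k : nat) :
  open W -> smooth_along setT W f -> smooth_along setT W g -> W x ->
  (forall alpha, (multi_order alpha <= k)%N ->
     multi_partial alpha f x = multi_partial alpha g x) <->
  (forall us, (size us <= k)%N -> derives us (f - g) x = 0).
Proof.
move=> oW sf sg Wx; split=> [fg us usk|fg alpha ak].
  apply: (derives_span_eq0 oW row_basis_sum (smooth_alongB oW sf sg) Wx _ erefl).
  move=> s ss; rewrite (derivesB oW _ sf sg Wx).
  rewrite !(derives_basis_multi_partial _ oW _ Wx)//.
  rewrite fg ?subrr// /multi_order (sum_count_mem s).
  by rewrite ss.
rewrite /multi_partial !partialsE; apply/eqP; rewrite -subr_eq0; apply/eqP.
by rewrite -(derivesB oW _ sf sg Wx) fg// size_map size_multi.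
Qed.

(** Only closure under products and derivatives matters here, so the polynomial
    functions are generated inductively instead of through coefficients. *)
Inductive poly_fun : ('rV[R]_n -> R) -> Prop :=
| poly_fun_cst (c : R) : poly_fun (cst c)
| poly_fun_coord (j : 'I_n) : poly_fun (fun x => x 0 j)
| poly_funD f g : poly_fun f -> poly_fun g -> poly_fun (f + g)
| poly_funM f g : poly_fun f -> poly_fun g -> poly_fun (f * g).

Lemma poly_fun_differentiable f x : poly_fun f -> differentiable f x.
Proof.
elim=> [c|j|g h _ dg _ dh|g h _ dg _ dh].
- exact: differentiable_cst.
- exact: differentiable_coord.
- exact: differentiableD.
- exact: differentiableM.
Qed.

Lemma poly_fun_derivable f u x : poly_fun f -> derivable f x u.
Proof. by move=> pf; apply/diff_derivable/poly_fun_differentiable. Qed.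

Lemma derive_coord (j : 'I_n) x u :
  'D_u (fun y : 'rV[R]_n => y 0 j) x = u 0 j.
Proof.
apply: lim_near_cst; first exact: norm_hausdorff.
rewrite near_withinE; apply: nearW => h h0 /=.
by rewrite !mxE addrK [_ *: _]mulKf.
Qed.

Lemma poly_fun_derive f u : poly_fun f -> poly_fun ('D_u f).
Proof.
elim=> [c|j|g h pg dg ph dh|g h pg dg ph dh].
- have -> : 'D_u (cst c : 'rV[R]_n -> R) = cst 0.
    by apply/funext => x; rewrite derive_cst.
  exact: poly_fun_cst.
- have -> : 'D_u (fun x : 'rV[R]_n => x 0 j) = cst (u 0 j).
    by apply/funext => x; rewrite derive_coord.
  exact: poly_fun_cst.
- have -> : 'D_u (g + h) = 'D_u g + 'D_u h.
    by apply/funext => x; apply: deriveD; exact: poly_fun_derivable.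
  exact: poly_funD.
- have -> : 'D_u (g * h) = g * 'D_u h + h * 'D_u g.
    by apply/funext => x; apply: deriveM; exact: poly_fun_derivable.
  by apply: poly_funD; exact: poly_funM.
Qed.

Lemma poly_funX f k : poly_fun f -> poly_fun (f ^+ k).
Proof.
move=> pf; elim: k => [|k IH]; first by rewrite expr0; exact: (poly_fun_cst 1).
by rewrite exprS; exact: poly_funM.
Qed.

Lemma poly_fun_smooth f : poly_fun f -> smooth_on setT f.
Proof.
move=> pf s x _; have ps : poly_fun (partials s f).
  by elim: s => //= i s; exact: poly_fun_derive.
split=> [|i]; last exact: poly_fun_derivable.
exact: differentiable_continuous (poly_fun_differentiable x ps).
Qed.

(** Each differentiation lowers the power of [f] by at most one. *)
Lemma derives_pow_eq0 f g us x (k : nat) : poly_fun f -> poly_fun g ->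
  f x = 0 -> (size us <= k)%N -> derives us (f ^+ k.+1 * g) x = 0.
Proof.
move=> pf + fx0; elim/last_ind: us k g => [|us u IH] k g pg.
  move=> _ /=; rewrite -[LHS]/((f ^+ k.+1) x * g x).
  by rewrite exprS -[(f * f ^+ k) x]/(f x * (f ^+ k) x) fx0 !mul0r.
rewrite size_rcons -cats1 derives_cat; case: k => // k usk /=.
have -> : 'D_u (f ^+ k.+2 * g) =
    f ^+ k.+1 * (f * 'D_u g + g * (cst k.+2%:R * 'D_u f)).
  apply/funext => x'.
  rewrite deriveM; [|exact/poly_fun_derivable/poly_funX|exact: poly_fun_derivable].
  rewrite deriveX; last exact: poly_fun_derivable.
  rewrite -[RHS]/((f ^+ k.+1) x' *
    (f x' * 'D_u g x' + g x' * (k.+2%:R * 'D_u f x'))).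
  rewrite exprS -[(f * f ^+ k.+1) x']/(f x' * (f ^+ k.+1) x').
  rewrite exprfctE/=.
  move: ('D_u g x') ('D_u f x') (f x') (g x') => a b c d.
  rewrite -[LHS]/(c * c ^+ k.+1 * a + d * (k.+2%:R * c ^+ k.+1 * b)); ring.
apply: IH => //; apply: poly_funD; apply: poly_funM => //.
- exact: poly_fun_derive.
- by apply: poly_funM; [exact: poly_fun_cst|exact: poly_fun_derive].
Qed.

(** Restriction to a line in direction [u] turns [D_u] into ordinary
    differentiation, by [is_derive_line]. *)
Lemma derives_line_poly f v u (P : {poly R}) (k : nat) :
  smooth_along setT setT f -> (forall s : R, f (v + s *: u) = P.[s]) ->
  forall s : R, derives (nseq k u) f (v + s *: u) = (P^`(k)).[s].
Proof.
move=> sf fP; elim: k => [|k IH] s //=.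
have dk : derivable (derives (nseq k u) f) (v + s *: u) u :=
  smooth_derivable (smooth_derives (nseq k u) sf) I I.
have [_ <-] := is_derive_line (derivableP dk).
rewrite derivE derive1E.
by congr ('D_1 _ s); apply/funext => t; exact: IH.
Qed.

End RowVectors.

(** * Barycentric coordinates *)

Section Barycentric.
Context {R : realType} {n : nat}.
Implicit Types (q : 'I_n.+1 -> 'rV[R]_n) (x y u : 'rV[R]_n).

(** Points are homogenized by a leading coordinate 1, so that affine
    independence of [q] becomes invertibility of this matrix. *)
Definition aff_mx q : 'M[R]_n.+1 :=
  \matrix_(i < n.+1) (row_mx (1%:M : 'M[R]_1) (q i) : 'rV[R]_n.+1).

(** Barycentric coordinates, as the coordinates of the homogenized point in the
    basis of the homogenized vertices. *)
Definition bary q (i : 'I_n.+1) x : R :=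
  ((row_mx (1%:M : 'M[R]_1) x : 'rV[R]_n.+1) *m invmx (aff_mx q)) 0 i.

(** The linear part of the affine function [bary q i]. *)
Definition dbary q (i : 'I_n.+1) u : R :=
  ((row_mx (0 : 'M[R]_1) u : 'rV[R]_n.+1) *m invmx (aff_mx q)) 0 i.

Lemma aff_mxE q i (j : 'I_(1 + n)) :
  aff_mx q i j = row_mx (1%:M : 'M[R]_1) (q i) 0 j.
Proof. by rewrite [LHS]mxE. Qed.

Lemma mul_aff_mx q (c : 'rV[R]_n.+1) :
  c *m aff_mx q =
  row_mx (\sum_i c 0 i)%:M (\sum_i c 0 i *: q i) :> 'rV[R]_(1 + n).
Proof.
apply/rowP => j; case: (split_ordP j) => j' ->.
  rewrite row_mxEl mxE [RHS]mxE ord1 eqxx mulr1n; apply: eq_bigr => i _.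
  by rewrite aff_mxE row_mxEl mxE eqxx mulr1.
rewrite row_mxEr mxE summxE; apply: eq_bigr => i _.
by rewrite aff_mxE row_mxEr mxE.
Qed.

Lemma aff_mx_unit q :
  (forall c : 'I_n.+1 -> R, \sum_i c i = 0 -> \sum_i c i *: q i = 0 ->
     forall i, c i = 0) -> aff_mx q \in unitmx.
Proof.
move=> indep; rewrite -row_free_unit -kermx_eq0; apply/rowV0P => c /sub_kermxP.
rewrite mul_aff_mx -[RHS](@row_mx0 _ 1 1 n) => E.
have [c0 cq0] := @eq_row_mx _ 1 1 n _ _ _ _ E.
apply/rowP => i; rewrite mxE; apply: indep cq0 i.
by move/matrixP/(_ 0 0): c0; rewrite !mxE eqxx mulr1n.
Qed.

Lemma affinely_independent_aff_mx q :
  affinely_independent q -> aff_mx q \in unitmx.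
Proof.
move=> fq; apply: aff_mx_unit => c c0 cq0.
pose X := [tuple of map (fun i : 'I_n => q (lift ord0 i) - q ord0) (ord_tuple n)].
have freeX : free X.
  by move: fq; rewrite /affinely_independent /image_mem -(val_ord_tuple n).
have cE : c ord0 = - \sum_(i < n) c (lift ord0 i).
  by apply/eqP; rewrite -addr_eq0 -big_ord_recl c0.
have cl i : c (lift ord0 i) = 0.
  have /freeP fX := freeX; apply: (fX (fun i => c (lift ord0 i))).
  rewrite -[RHS]cq0 big_ord_recl cE scaleNr scaler_suml -sumrN -big_split/=.
  apply: eq_bigr => j _.
  by rewrite -(tnth_nth 0 X) tnth_map tnth_ord_tuple scalerBr addrC.
move=> i; have [j ->|->] := unliftP ord0 i; first exact: cl.
by rewrite cE big1 ?oppr0// => j _; exact: cl.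
Qed.

Lemma bary_line q i x u (t : R) :
  bary q i (x + t *: u) = bary q i x + t * dbary q i u.
Proof.
rewrite /bary /dbary.
have -> : row_mx 1%:M (x + t *: u) =
    row_mx 1%:M x + t *: row_mx 0 u :> 'rV[R]_(1 + n).
  by rewrite scale_row_mx add_row_mx scaler0 addr0.
by rewrite mulmxDl -scalemxAl !mxE.
Qed.

Lemma dbaryB q i x y : dbary q i (x - y) = bary q i x - bary q i y.
Proof.
have := bary_line q i y (x - y) 1.
by rewrite scale1r mul1r addrC subrK => ->; rewrite addrAC subrr add0r.
Qed.

Lemma dbary_sum q i (I : finType) (u : I -> 'rV[R]_n) :
  dbary q i (\sum_j u j) = \sum_j dbary q i (u j).
Proof.
have add x y : dbary q i (x + y) = dbary q i x + dbary q i y.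
  rewrite /dbary.
  have -> : row_mx 0 (x + y) = row_mx 0 x + row_mx 0 y :> 'rV[R]_(1 + n).
    by rewrite add_row_mx addr0.
  by rewrite mulmxDl mxE.
apply: (big_morph _ add).
by have := dbaryB q i 0 0; rewrite !subrr.
Qed.

Lemma poly_fun_bary q i : poly_fun (bary q i).
Proof.
pose M := invmx (aff_mx q).
have -> : bary q i = cst (@usubmx _ 1 n _ M ord0 i) +
    \sum_(j < n) ((fun x : 'rV[R]_n => x 0 j) * cst (@dsubmx _ 1 n _ M j i)).
  apply/funext => x; rewrite -[RHS]/(_ + (\sum_(j < n) _) x) fct_sumE.
  have := @mul_row_col _ _ 1 n _ 1%:M x (@usubmx _ 1 n _ M) (@dsubmx _ 1 n _ M).
  rewrite vsubmxK mul1mx => /matrixP/(_ 0 i) E.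
  by rewrite [LHS]E mxE; congr (_ + _); rewrite mxE.
apply: poly_funD; first exact: poly_fun_cst.
elim/big_ind: _ => [|? ?|j _]; [exact: (poly_fun_cst 0)|exact: poly_funD|].
by apply: poly_funM; [exact: poly_fun_coord|exact: poly_fun_cst].
Qed.

(** Barycentric coordinates are affine, hence respect affine dependencies. *)
Lemma bary_dependency q q' i (c : 'I_n.+1 -> R) :
  \sum_j c j = 0 -> \sum_j c j *: q' j = 0 ->
  \sum_j c j * bary q i (q' j) = 0.
Proof.
move=> c0 cq0; pose C : 'rV[R]_n.+1 := \row_j c j.
have C0 : C *m aff_mx q' = 0.
  have C0j j : C 0 j = c j by rewrite mxE.
  rewrite mul_aff_mx (eq_bigr _ (fun j _ => C0j j)) c0.
  rewrite (eq_bigr _ (fun j _ => congr1 ( *:%R^~ (q' j)) (C0j j))) cq0.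
  by rewrite raddf0 row_mx0.
have : (C *m (aff_mx q' *m invmx (aff_mx q))) 0 i = 0.
  by rewrite mulmxA C0 mul0mx mxE.
rewrite mxE => E; rewrite -[RHS]E.
apply: eq_bigr => j _; rewrite [C _ _]mxE; congr (_ * _).
have -> : bary q i (q' j) = (row j (aff_mx q') *m invmx (aff_mx q)) 0 i.
  by rewrite rowK.
by rewrite -row_mul mxE.
Qed.

Section Unit.
Variable q : 'I_n.+1 -> 'rV[R]_n.
Hypothesis qU : aff_mx q \in unitmx.

Lemma bary_vertex i j : bary q i (q j) = (i == j)%:R.
Proof.
have -> : bary q i (q j) = (row j (aff_mx q) *m invmx (aff_mx q)) 0 i.
  by rewrite rowK.
by rewrite -row_mul mulmxV// !mxE eq_sym.
Qed.

Lemma dbary_edges k u : u = \sum_i dbary q (lift k i) u *: (q (lift k i) - q k).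
Proof.
have E : row_mx 0 u = row_mx (\sum_i dbary q i u)%:M
                             (\sum_i dbary q i u *: q i) :> 'rV[R]_(1 + n).
  by rewrite -mul_aff_mx mulmxKV.
have [c0 {1}->] := eq_row_mx E.
have {}c0 : \sum_i dbary q i u = 0.
  by move/matrixP/(_ 0 0): c0; rewrite !mxE eqxx mulr1n.
rewrite (bigD1_ord k)//= in c0.
rewrite (bigD1_ord k)//=.
have -> : dbary q k u = - \sum_i dbary q (lift k i) u.
  by apply/eqP; rewrite -addr_eq0 c0.
rewrite scaleNr scaler_suml -sumrN -big_split/=.
by apply: eq_bigr => i _; rewrite scalerBr addrC.
Qed.

End Unit.

Lemma conv_hull_bary q i (a b : R) (A : set 'rV[R]_n) :
  (forall x, A x -> a <= bary q i x <= b) ->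
  forall x, conv_hull A x -> a <= bary q i x <= b.
Proof.
move=> Aab; apply: smallest_sub => // x y l.
rewrite !inE /= => /andP[ax xb] /andP[ay yb].
have -> : conv l x y = y + l%:num *: (x - y) :> 'rV[R]_n.
  rewrite -[LHS]/(l%:num *: x + (1 - l%:num) *: y).
  by rewrite scalerBl scale1r addrCA -scalerBr.
rewrite bary_line dbaryB.
have l0 : 0 <= l%:num by [].
have l1 : l%:num <= 1 by [].
by apply/andP; split; nra.
Qed.

End Barycentric.

(** * The geometry and the splines of a 2-cell *)

Section TwoCell.
Context {R : realType} {n : nat}.
Variable D : two_cell R n.
Hypothesis n_gt0 : (0 < n)%N.

Notation p := (cell_vertex D).
Notation q := (cell_T1_vertex D).
Notation k := (cell_opp D).
Notation v := (cell_center D).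

Let pU : aff_mx p \in unitmx := affinely_independent_aff_mx (cell_indep D).

Let qk : q k = v. Proof. by rewrite /cell_T1_vertex eqxx. Qed.

Let q_neq i : i != k -> q i = p i.
Proof. by move=> /negbTE ik; rewrite /cell_T1_vertex ik. Qed.

Let T_bary x : cell_T D x -> 0 <= bary p k x.
Proof.
move=> Tx; suff /andP[] : 0 <= bary p k x <= 1 by [].
apply: conv_hull_bary Tx => _ [i _ <-]; rewrite bary_vertex//.
by rewrite ler0n lern1 leq_b1.
Qed.

Let rising_direction : exists u, dbary p k u = 1.
Proof.
exists (p k - p (lift k (Ordinal n_gt0))); rewrite dbaryB !bary_vertex//.
by rewrite eqxx (negbTE (neq_lift _ _)) subr0.
Qed.

(** Since the centre is interior, the coordinate can still decrease there without
    leaving the cell. *)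
Lemma cell_center_bary_gt0 : 0 < bary p k v.
Proof.
have [u uk] := rising_direction.
have [t t0 /T_bary] := nbhs_ray (- u) (cell_centerP D).
by rewrite scalerN -scaleNr bary_line uk; lra.
Qed.

Lemma cell_T1_bary x : cell_T1 D x -> bary p k x <= bary p k v.
Proof.
rewrite cell_T1_simplex => T1x.
suff /andP[] : 0 <= bary p k x <= bary p k v by [].
have v0 := ltW cell_center_bary_gt0.
apply: conv_hull_bary T1x => _ [i _ <-].
have [->|ik] := eqVneq i k; first by rewrite qk v0 lexx.
by rewrite q_neq// bary_vertex// eq_sym (negbTE ik) lexx v0.
Qed.

(** Moving from the centre so that the coordinate at the vertex [k] increases
    leaves [cell_T1] at once, by [cell_T1_bary]. This is what makes the second piece of a spline smooth at the
    centre. *)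
Lemma cell_center_T2 : cell_T2 D v.
Proof.
move=> N Nv; have [u uk] := rising_direction.
have [t t0 [Tt Nt]] := nbhs_ray u (filterI (cell_centerP D) Nv).
exists (v + t *: u); split=> //; split=> // /cell_T1_bary.
by rewrite bary_line uk; lra.
Qed.

Lemma cell_center_T1 : cell_T1 D v.
Proof. by apply: sub_gen_smallest; left. Qed.

(** The inner piece is a non-degenerate simplex: its apex has a positive
    coordinate at [k], where the other vertices have coordinate 0. *)
Lemma cell_T1_aff_mx : aff_mx q \in unitmx.
Proof.
apply: aff_mx_unit => c c0 cq0.
have ck : c k = 0.
  have := bary_dependency p k c0 cq0; rewrite (bigD1 k)//= qk big1 => [|j jk].
    rewrite addr0 => /eqP; rewrite mulf_eq0.
    by rewrite (gt_eqF cell_center_bary_gt0) orbF => /eqP.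
  by rewrite q_neq// bary_vertex// eq_sym (negbTE jk) mulr0.
move=> i; have [->//|ik] := eqVneq i k.
have := bary_dependency p i c0 cq0; rewrite (bigD1 k)//= ck mul0r add0r.
rewrite (bigD1 i)//= q_neq// bary_vertex// eqxx mulr1 big1 ?addr0// => j.
by move=> /andP[jk ji]; rewrite q_neq// bary_vertex// eq_sym (negbTE ji) mulr0.
Qed.

Let qU : aff_mx q \in unitmx := cell_T1_aff_mx.

Notation edge := (fun i : 'I_n => q (lift k i) - v).

Let edge_span u : exists c : 'I_n -> R, u = \sum_i c i *: edge i.
Proof.
exists (fun i => dbary q (lift k i) u); rewrite {1}(dbary_edges qU k u).
by apply: eq_bigr => i _; rewrite qk.
Qed.

Let facet_vertex i j : j != i -> facet q i (q j).
Proof. by move=> ji; apply: sub_gen_smallest; exists j. Qed.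

Let facet_center i : facet q (lift k i) v.
Proof. by rewrite -qk; apply: facet_vertex; rewrite neq_lift. Qed.

Let facet_edge i j : j != i -> facet q (lift k i) (v + edge j).
Proof.
by move=> ji; rewrite addrC subrK; apply: facet_vertex; rewrite (inj_eq lift_inj).
Qed.

(** The face opposite to the centre does not contain it, because the barycentric
    coordinate of the centre at itself is 1. *)
Lemma interior_face_bary F : interior_faces D F ->
  exists2 j, j != k & forall x, F x -> bary q j x = 0.
Proof.
move=> [Fv [j FE]].
have F0 x : F x -> bary q j x = 0.
  rewrite FE => Fx; apply/le_anti/andP/andP; rewrite andbC.
  apply: conv_hull_bary Fx => _ [i /= ij <-].
  by rewrite bary_vertex// eq_sym (negbTE ij) lexx.
exists j => //; apply/eqP => jk; have /eqP := F0 v Fv.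
by rewrite -qk bary_vertex// jk eqxx oner_eq0.
Qed.

Section Matching.
Variable sigma : spline D.
Let W := spline_U1 sigma `&` spline_U2 sigma.
Let g := spline_f1 sigma - spline_f2 sigma.

Let oW : open W.
Proof. by apply: openI; [exact: spline_U1_open|exact: spline_U2_open]. Qed.

Let Wv : W v.
Proof.
by split; [exact: spline_U1_sub cell_center_T1|exact: spline_U2_sub cell_center_T2].
Qed.

Let s1 : smooth_along setT W (spline_f1 sigma).
Proof.
by apply: smooth_on_along => // s x [U1x _]; exact: spline_f1_smooth.
Qed.

Let s2 : smooth_along setT W (spline_f2 sigma).
Proof.
by apply: smooth_on_along => // s x [_ U2x]; exact: spline_f2_smooth.
Qed.

Lemma spline_Sr_Crho (r rho : nat) : (rho < n * r.+1)%N ->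
  spline_Sr D r sigma -> spline_Crho D rho sigma.
Proof.
move=> rho_lt Sr; apply/(multi_partial_derives rho oW s1 s2 Wv) => us usrho.
have sg : smooth_along setT W g := smooth_alongB oW s1 s2.
apply: (derives_span_eq0 oW edge_span sg Wv _ erefl) => s ss.
apply: (@flat_faces_derives_eq0 _ _ W oW n r edge
          (fun i => facet q (lift k i)) v g sg Wv).
- by move=> i; exact: convex_conv_hull.
- exact: facet_center.
- exact: facet_edge.
- move=> i x Fx Wx; apply/(multi_partial_derives r oW s1 s2 Wx) => alpha ar.
  apply: Sr ar _ _ _ Fx; split; first exact: facet_center.
  by exists (lift k i).
- by rewrite ss (leq_ltn_trans usrho).
Qed.

End Matching.

(** The walls are the hyperplanes carrying the interior faces; each barycentric
    factor vanishes on one of them. *)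
Definition wall_product (r : nat) : 'rV[R]_n -> R :=
  \prod_(i < n) bary q (lift k i) ^+ r.+1.

Lemma poly_fun_wall_product r : poly_fun (wall_product r).
Proof.
rewrite /wall_product; elim/big_ind: _ => [|? ?|i _].
- exact: (poly_fun_cst 1).
- exact: poly_funM.
- exact/poly_funX/poly_fun_bary.
Qed.

Definition wall_spline (r : nat) : spline D :=
  Spline openT (@subsetT _ _) (poly_fun_smooth (poly_fun_wall_product r))
         openT (@subsetT _ _) (poly_fun_smooth (poly_fun_cst 0)).

Let wallE r us x :
  derives us (wall_product r - cst 0) x = derives us (wall_product r) x.
Proof. by rewrite subr0. Qed.

Let swall r : smooth_along setT setT (wall_product r).
Proof.
by apply: smooth_on_along openT _; exact: poly_fun_smooth (poly_fun_wall_product r).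
Qed.

Let s0 : smooth_along setT setT (cst 0 : 'rV[R]_n -> R).
Proof.
by apply: smooth_on_along openT _; exact: poly_fun_smooth (poly_fun_cst 0).
Qed.

Lemma wall_spline_Sr r : spline_Sr D r (wall_spline r).
Proof.
move=> alpha ar F Fint x Fx.
have [j jk /(_ x Fx) bx] := interior_face_bary Fint.
move: alpha ar; apply/(multi_partial_derives r openT (swall r) s0 I) => us usr.
rewrite wallE; have [i jE|jE] := unliftP k j; last by rewrite jE eqxx in jk.
rewrite /wall_product (bigD1 i)//= -jE; apply: derives_pow_eq0 => //.
- exact: poly_fun_bary.
- elim/big_ind: _ => [|? ?|h _]; [exact: (poly_fun_cst 1)|exact: poly_funM|].
  exact/poly_funX/poly_fun_bary.
Qed.

(** On the line from the centre along the sum of all edges every barycentric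
    factor equals the parameter [t], so the product is [t ^+ (n * r.+1)], which
    has a nonzero derivative of that order at 0. *)
Lemma wall_spline_NCrho r rho : (n * r.+1 <= rho)%N ->
  ~ spline_Crho D rho (wall_spline r).
Proof.
move=> rho_ge /(multi_partial_derives rho openT (swall r) s0 I) C.
pose u := \sum_(i < n) edge i.
have uline (t : R) : wall_product r (v + t *: u) = ('X^(n * r.+1)).[t].
  rewrite /wall_product fct_prodE hornerXn mulnC exprM.
  rewrite -[n in RHS]card_ord -prodr_const.
  apply: eq_bigr => i _; rewrite exprfctE; congr (_ ^+ _).
  rewrite bary_line -[X in bary _ _ X + _]qk bary_vertex//.
  rewrite eq_sym (negbTE (neq_lift _ _)) add0r.
  rewrite dbary_sum (bigD1 i)//= big1 => [|j ji].
    rewrite dbaryB -qk !bary_vertex// eqxx eq_sym (negbTE (neq_lift _ _)).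
    by rewrite subr0 addr0 mulr1.
  rewrite dbaryB -qk !bary_vertex// (inj_eq lift_inj) eq_sym (negbTE ji).
  by rewrite eq_sym (negbTE (neq_lift _ _)) subr0.
have := derives_line_poly (n * r.+1) (swall r) uline 0.
rewrite scale0r addr0 -wallE C ?size_nseq// derivnXn ffactnn subnn expr0.
rewrite hornerMn hornerC => /esym/eqP; rewrite pnatr_eq0.
by rewrite eqn0Ngt fact_gt0.
Qed.

End TwoCell.

(** * The order of supersmoothness *)

Theorem theorem6 (R : realType) (n : nat) (n_gt0 : (0 < n)%N)
  (D : two_cell R n) (r : nat) : mos_Sr D r (r + (n - 1) * (r + 1))%N.
Proof.
have mE : (r + (n - 1) * (r + 1)).+1 = (n * r.+1)%N.
  by rewrite -[in RHS](prednK n_gt0) subn1 addn1 mulSn addSn.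
split=> [|rho [_ Sr_sub]].
  split; first exact: leq_addr.
  by move=> sigma; apply: spline_Sr_Crho => //; rewrite -mE.
rewrite leEnat leqNgt; apply/negP; rewrite mE => rho_ge.
apply: (wall_spline_NCrho n_gt0 rho_ge); apply: Sr_sub.
exact: wall_spline_Sr.
Qed.
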